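(* Let $n\in\mathbb{N}\cup\{0\}$, $\nu>0$ and $\lambda\in\mathbb{R}$. Then the function $x\mapsto E_{n;\nu,1}(\lambda x^\nu)$, $x\ge 0$, is an eigenfunction of the fractional hyper-Bessel-type operator $$\underbrace{\frac{\mathrm d^\nu}{\mathrm dx^\nu}\, x^\nu\, \frac{\mathrm d^\nu}{\mathrm dx^\nu}\cdots \frac{\mathrm d^\nu}{\mathrm dx^\nu}\, x^\nu\, \frac{\mathrm d^\nu}{\mathrm dx^\nu}}_{n+1\text{ derivatives}},$$ where $\mathrm d^\nu/\mathrm dx^\nu$ denotes the Caputo fractional derivative of order $\nu$.
   Context: For $\alpha>-1$, $\nu>0$, $\gamma\in\mathbb{R}$, the $\alpha$-Mittag--Leffler function is $E_{\alpha;\nu,\gamma}(x)=\sum_{k=0}^\infty \frac{x^k}{\Gamma^{\alpha+1}(\nu k+\gamma)}$, where $\Gamma^{\alpha+1}(\cdot)=(\Gamma(\cdot))^{\alpha+1}$. In particular $E_{n;\nu,1}(\lambda x^\nu)=\sum_{k=0}^\infty \frac{\lambda^k x^{\nu k}}{\Gamma^{n+1}(\nu k+1)}$. The Caputo fractional derivative of order $\nu>0$ has starting point $0$: with $m=\lceil \nu\rceil$, $\frac{\mathrm d^\nu}{\mathrm dx^\nu}f(x)=\frac{1}{\Gamma(m-\nu)}\int_0^x (x-t)^{m-\nu-1} f^{(m)}(t)\,\mathrm dt$ if $\nu\notin\mathbb{N}$, and it is the ordinary derivative $f^{(\nu)}(x)$ if $\nu\in\mathbb{N}$. It is computed for $x>0$,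 with values at $x=0$ understood as limits $x\to0^+$. The operator is a composition, applied from right to left, of $n+1$ Caputo derivatives of order $\nu$ with multiplication by $x^\nu$ between each two consecutive derivatives ($n$ multiplications in total); for $n=0$ it is $\mathrm d^\nu/\mathrm dx^\nu$. A function $f$, not identically zero, is an eigenfunction of an operator $L$ if $Lf=cf$ for some constant $c\in\mathbb{R}$. *)

(* Defs.v *)
From HB Require Import structures.
From mathcomp Require Import all_boot all_order all_algebra.
From mathcomp Require Import all_classical all_reals all_analysis.

Set Implicit Arguments.
Unset Strict Implicit.
Unset Printing Implicit Defensive.

Import Order.TTheory GRing.Theory Num.Theory.
Import numFieldNormedType.Exports.

Local Open Scope classical_set_scope.
Local Open Scope ring_scope.

Section Defs.
Context {R : realType}.
Implicit Types (f : R -> R) (nu x : R).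

Local Notation mu := (@lebesgue_measure R).

(* Euler's integral; it is the Gamma function for z > 0 only. *)
Definition Gamma (z : R) : R :=
  \int[mu]_(t in `]0, +oo[) (t `^ (z - 1) * expR (- t)).

(* Meaningful when nu * k + gamma > 0 for all k, i.e. nu >= 0 and gamma > 0:
   see Gamma, and powR is the usual real power only for a base >= 0. *)
Definition mittag_leffler (alpha nu gamma x : R) : R :=
  limn (series (fun k : nat =>
    x ^+ k / Gamma (nu * k%:R + gamma) `^ (alpha + 1))).

Definition caputo_order nu : nat := `|Num.ceil nu|%N.

Definition caputo_kernel nu f x (t : R) : R :=
  (x - t) `^ ((caputo_order nu)%:R - nu - 1) * derive1n (caputo_order nu) f t.

Definition caputo_pos nu f x : R :=
  if nu \is a Num.nat then derive1n (caputo_order nu) f x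
  else (Gamma ((caputo_order nu)%:R - nu))^-1 *
       \int[mu]_(t in `]0, x[) caputo_kernel nu f x t.

(* Functions on the half-line [0, +oo[ are represented by functions R -> R
   whose values at negative reals are irrelevant. *)
Definition caputo nu f x : R :=
  if x == 0 then lim (caputo_pos nu f y @[y --> 0^'+])
  else caputo_pos nu f x.

(* The operator caputo is total, with default values for non-existent
   derivatives, integrals and limits; this predicate says that none of these
   default values is used on [0, +oo[. *)
Definition caputo_defined nu f : Prop :=
  [/\ forall (k : nat) x, (k < caputo_order nu)%N -> 0 < x ->
        derivable (derive1n k f) x 1,
      nu \isn't a Num.nat -> forall x, 0 < x ->
        mu.-integrable `]0, x[ (EFin \o caputo_kernel nu f x)
    & cvg (caputo_pos nu f y @[y --> 0^'+])].

Definition mul_powR nu f x : R := x `^ nu * f x.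

(* n + 1 Caputo derivatives, separated by n multiplications by x^nu. *)
Definition hyper_bessel (n : nat) nu f : R -> R :=
  iter n (fun g => caputo nu (mul_powR nu g)) (caputo nu f).

Definition hyper_bessel_defined (n : nat) nu f : Prop :=
  caputo_defined nu f /\
  forall k : nat, (k < n)%N ->
    caputo_defined nu (mul_powR nu (hyper_bessel k nu f)).

(* f is in the domain of the operator L on functions on [0, +oo[, is not
   identically zero, and L f = c f for some constant c. *)
Definition eigenfunction (dom : (R -> R) -> Prop) (L : (R -> R) -> R -> R) f :
    Prop :=
  [/\ dom f, exists2 x, 0 <= x & f x != 0
    & exists c : R, forall x, 0 <= x -> L f x = c * f x].

End Defs.

(* Main.v *)
(** Write the function as F(x^nu) for x >= 0, where F is the sum of an everywhere
    convergent power series with coefficients a_k, and let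
    rho_k = Gamma(nu (k+1) + 1) / Gamma(nu k + 1).
    A function x^s F(x^nu) has derivative x^(s-1) G(x^nu), where G has the
    coefficients (s + nu k) a_k, so derivatives of any order are again of this
    form; the term k = 0 disappears, and what remains is O(x^(nu-m)) with
    nu - m > -1.  Dominated convergence and Euler's Beta integral then show that
    the Caputo derivative of F(x^nu) is the power series in x^nu with
    coefficients rho_k a_(k+1), for integer nu too.  Multiplication by x^nu
    undoes the shift of the index, so n+1 derivatives produce the coefficients
    rho_k^(n+1) a_(k+1), and for a_k = lambda^k / Gamma(nu k + 1)^(n+1) these are
    lambda a_k.  The facts needed on Gamma all come from Euler's integral:
    Gamma(p) Gamma(q) = Gamma(p+q) B(p,q) by Tonelli, and
    Gamma(q+1) = q Gamma(q) because B(1,q) = 1/q. *)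

Require Import Defs.
From HB Require Import structures.
From mathcomp Require Import all_boot all_order all_algebra.
From mathcomp Require Import all_classical all_reals all_analysis.
From mathcomp Require Import measurable_realfun ring lra.
Import Order.TTheory GRing.Theory Num.Theory.
Import numFieldNormedType.Exports.
Local Open Scope classical_set_scope.
Local Open Scope ring_scope.

(** * Affine change of variables *)

Section change_of_variables.
Set Implicit Arguments.
Unset Strict Implicit.
Context {R : realType}.
Local Notation mu := (@lebesgue_measure R).
Local Open Scope ereal_scope.

Lemma measurable_affine (a b : R) :
  measurable_fun [set: R] (fun x : R => a * x + b)%R.
Proof. by apply: measurable_funD => //; exact: measurable_funM. Qed.

(** By uniqueness of Lebesgue measure: the pushforward of [mu] under the affine map, scaled by [a],
    gives every half-open interval its length. *)
Lemma lebesgue_measure_affine (a b : R) (A : set R) : (0 < a)%R ->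
  measurable A -> mu A = a%:E * mu ((fun x : R => a * x + b)%R @^-1` A).
Proof.
move=> a0 mA.
pose phi : measurableTypeR R -> measurableTypeR R := (fun x : R => a * x + b)%R.
have mphi : measurable_fun setT phi by exact: measurable_affine.
have [nu nuE] : exists nu : {measure set (measurableTypeR R) -> \bar R},
    forall X, nu X = a%:E * mu (phi @^-1` X).
  by unshelve eexists (mscale (NngNum (ltW a0)) (pushforward mu phi)).
rewrite -nuE; apply: lebesgue_measure_unique => // X [[c d] _ <-] /=.
rewrite nuE.
rewrite (_ : phi @^-1` _ = `]((c - b) / a)%R, ((d - b) / a)%R]%classic); last first.
  apply/seteqP; split=> x /=; rewrite !in_itv /= /phi.
    by move=> /andP[? ?]; rewrite ltr_pdivrMr // ler_pdivlMr //; lra.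
  by move=> /andP[]; rewrite ltr_pdivrMr // ler_pdivlMr //; lra.
rewrite !lebesgue_measure_itv /= !lte_fin ltr_pM2r ?invr_gt0 // ltrD2r.
case: ifP => _; last by rewrite mule0.
rewrite -!EFinB -EFinM; congr EFin; field; exact: lt0r_neq0.
Qed.

(** Stated for nonnegative extended-real functions, so that it applies before any integral is known
    to be finite. *)
Lemma ge0_integral_affine (a b : R) (f : R -> \bar R) : (0 < a)%R ->
  measurable_fun setT f -> (forall x, 0 <= f x) ->
  \int[mu]_x f x = a%:E * \int[mu]_x f (a * x + b)%R.
Proof.
move=> a0 mf f0.
pose phi : measurableTypeR R -> measurableTypeR R := (fun x : R => a * x + b)%R.
have mphi : measurable_fun setT phi by exact: measurable_affine.
have f0' : {in setT, forall x, 0 <= f x} by move=> x _.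
have [nu nuE] : exists nu : {measure set (measurableTypeR R) -> \bar R},
    nu = pushforward mu phi :> (set _ -> \bar R).
  by unshelve eexists (pushforward mu phi).
have := ge0_integral_pushforward mphi mu measurableT mf f0'.
rewrite -nuE => <-.
have <- := @ge0_integral_mscale _ _ _ nu setT measurableT
  (NngNum (ltW a0)) f mf (fun x _ => f0 x).
apply: eq_measure_integral => // A mA _; rewrite /= /mscale nuE.
exact: lebesgue_measure_affine.
Qed.

End change_of_variables.

(** * The Gamma and Beta integrals *)

Section gamma_kernel.
Set Implicit Arguments.
Unset Strict Implicit.
Context {R : realType}.
Local Notation mu := (@lebesgue_measure R).
Implicit Types p q t u x : R.

(** Extension by zero lets translations and substitutions act on integrals over the whole line, the
    support conditions taking care of themselves. *)
Definition gamma_kernel p : R -> R :=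
  (fun t => t `^ (p - 1) * expR (- t)) \_ `]0, +oo[.

Definition beta_kernel p q : R -> R :=
  (fun t => (1 - t) `^ (p - 1) * t `^ (q - 1)) \_ `]0, 1[.

(** Kept extended-real because finiteness is itself derived from the identities between these
    integrals. *)
Definition eGamma p : \bar R := (\int[mu]_x (gamma_kernel p x)%:E)%E.

Definition eBeta p q : \bar R := (\int[mu]_x (beta_kernel p q x)%:E)%E.

Lemma integral_restrict_EFin (D : set R) (f : R -> R) :
  (\int[mu]_x ((f \_ D) x)%:E = \int[mu]_(x in D) (f x)%:E)%E.
Proof.
by rewrite [RHS]integral_mkcond; apply: eq_integral => x _; rewrite restrict_EFin.
Qed.

Lemma GammaE p : Gamma p = fine (eGamma p).
Proof. by rewrite /eGamma integral_restrict_EFin. Qed.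

Lemma gamma_kernel_gt0E p t : 0 < t ->
  gamma_kernel p t = t `^ (p - 1) * expR (- t).
Proof. by move=> t0; rewrite /gamma_kernel patchE ifT // inE/= in_itv/= t0. Qed.

Lemma gamma_kernel_le0E p t : t <= 0 -> gamma_kernel p t = 0.
Proof.
move=> t0; rewrite /gamma_kernel patchE ifF //; apply/negP.
by rewrite inE/= in_itv/= andbT ltNge t0.
Qed.

Lemma gamma_kernel_ge0 p t : 0 <= gamma_kernel p t.
Proof.
have [t0|t0] := leP t 0; first by rewrite gamma_kernel_le0E.
by rewrite gamma_kernel_gt0E // mulr_ge0 ?powR_ge0 ?expR_ge0.
Qed.

Lemma beta_kernel_ge0 p q t : 0 <= beta_kernel p q t.
Proof. by apply: restrict_ge0 => x _; rewrite mulr_ge0 ?powR_ge0. Qed.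

Lemma measurable_gamma_kernel p : measurable_fun [set: R] (gamma_kernel p).
Proof.
apply/(measurable_restrictT _ _).1 => //; apply: measurable_funTS.
apply: measurable_funM; first exact: measurable_powR.
by apply: measurableT_comp => //; exact: measurable_expR.
Qed.

Lemma measurable_beta_kernel p q : measurable_fun [set: R] (beta_kernel p q).
Proof.
apply/(measurable_restrictT _ _).1 => //; apply: measurable_funTS.
apply: measurable_funM; last exact: measurable_powR.
apply: (measurableT_comp (measurable_powR _)); exact: measurable_funB.
Qed.

(** The exponentials multiply to e^(-u) and the powers of u to u^(p+q-1), the leading u being the
    Jacobian. For t outside ]0, 1[ one of the two Gamma kernels vanishes. *)
Lemma gamma_kernel_beta_kernel p q u t : 0 < u ->
  u * (gamma_kernel p (u - u * t) * gamma_kernel q (u * t)) =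
  gamma_kernel (p + q) u * beta_kernel p q t.
Proof.
move=> u0; rewrite /beta_kernel patchE; case: ifPn; last first.
  rewrite notin_setE /= in_itv /= => /negP; rewrite negb_and -!leNgt mulr0.
  move=> /orP[t0|t1].
    by rewrite (@gamma_kernel_le0E q) ?mulr0 // pmulr_rle0.
  rewrite (@gamma_kernel_le0E p) ?mul0r ?mulr0 //.
  by rewrite -[X in X - _]mulr1 -mulrBr pmulr_rle0 // subr_le0.
rewrite inE /= in_itv /= => /andP[t0 t1].
have t1' : 0 < 1 - t by rewrite subr_gt0.
have -> : u - u * t = u * (1 - t) by rewrite mulrBr mulr1.
rewrite !gamma_kernel_gt0E ?mulr_gt0 //.
rewrite !powRM ?(ltW u0) ?(ltW t0) ?(ltW t1') //.
have -> : u `^ (p + q - 1) = u * (u `^ (p - 1) * u `^ (q - 1)).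
  rewrite -{2}[u](@powRr1 _ u) ?(ltW u0) // -!powRD ?(gt_eqF u0) ?implybT //.
  by congr (_ `^ _); ring.
have -> : expR (- u) = expR (- (u * (1 - t))) * expR (- (u * t)).
  by rewrite -expRD; congr expR; ring.
ring.
Qed.

(* Substituting [t = u s] separates the variables [u] and [s]. *)
Lemma gamma_kernel_convolution p q u :
  (\int[mu]_t (gamma_kernel p (u - t) * gamma_kernel q t)%:E =
   (gamma_kernel (p + q) u)%:E * eBeta p q)%E.
Proof.
have [u0|u0] := leP u 0.
  rewrite gamma_kernel_le0E // mul0e; apply: integral0_eq => t _.
  have [t0|t0] := leP t 0; first by rewrite (@gamma_kernel_le0E q) ?mulr0.
  by rewrite gamma_kernel_le0E ?mul0r // subr_le0 (le_trans u0 (ltW t0)).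
have mg : measurable_fun setT (fun t => gamma_kernel p (u - t) * gamma_kernel q t).
  apply: measurable_funM; last exact: measurable_gamma_kernel.
  apply: (measurableT_comp (measurable_gamma_kernel _)); exact: measurable_funB.
rewrite (ge0_integral_affine 0 u0); last 2 first.
- exact/measurable_EFinP.
- by move=> t; rewrite lee_fin mulr_ge0 ?gamma_kernel_ge0.
rewrite -ge0_integralZl_EFin //; last 3 first.
- by move=> t _; rewrite lee_fin mulr_ge0 ?gamma_kernel_ge0.
- apply/measurable_EFinP; apply: (measurableT_comp mg).
  exact: measurable_affine.
- exact: ltW.
rewrite -ge0_integralZl_EFin //; last 3 first.
- by move=> t _; rewrite lee_fin beta_kernel_ge0.
- by apply/measurable_EFinP; exact: measurable_beta_kernel.
- exact: gamma_kernel_ge0.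
by apply: eq_integral => t _; rewrite addr0 -!EFinM gamma_kernel_beta_kernel.
Qed.

(** Tonelli for the convolution integrand: integrating in t first gives the right-hand side,
    integrating in u first gives the product on the left. *)
Lemma eGammaM p q : (eGamma p * eGamma q = eGamma (p + q) * eBeta p q)%E.
Proof.
pose F (z : R * R) : \bar R := (gamma_kernel p (z.1 - z.2) * gamma_kernel q z.2)%:E.
have F0 z : (0 <= F z)%E by rewrite lee_fin mulr_ge0 ?gamma_kernel_ge0.
have mF : measurable_fun setT F.
  apply/measurable_EFinP; apply: measurable_funM.
    apply: (measurableT_comp (measurable_gamma_kernel _)).
    by apply: measurable_funB; [exact: measurable_fst|exact: measurable_snd].
  exact: (measurableT_comp (measurable_gamma_kernel _)).
have mg r : measurable_fun setT (fun x => (gamma_kernel r x)%:E).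
  by apply/measurable_EFinP; exact: measurable_gamma_kernel.
have G0 r : (0 <= eGamma r)%E.
  by apply: integral_ge0 => x _; rewrite lee_fin gamma_kernel_ge0.
have B0 : (0 <= eBeta p q)%E.
  by apply: integral_ge0 => x _; rewrite lee_fin beta_kernel_ge0.
have := @fubini_tonelli _ _ _ _ _ mu mu F mF F0.
under eq_integral do rewrite gamma_kernel_convolution.
rewrite (ge0_integralZr mu measurableT (mg (p + q))) //; last first.
  by move=> x _; rewrite lee_fin gamma_kernel_ge0.
(* For fixed t the integral in u is [eGamma p] by translation invariance. *)
move=> ->; have inner t :
    (\int[mu]_u F (u, t) = eGamma p * (gamma_kernel q t)%:E)%E.
  rewrite /eGamma.
  rewrite (@ge0_integral_affine R 1 (- t) (fun x => (gamma_kernel p x)%:E)) //;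
    last first.
    by move=> u; rewrite lee_fin gamma_kernel_ge0.
  have mf1 : measurable_fun setT (fun u => (gamma_kernel p (1 * u + - t))%:E).
    by apply: (measurableT_comp (mg p)); exact: measurable_affine.
  have f1 u : setT u -> (0 <= (gamma_kernel p (1 * u + - t))%:E)%E.
    by move=> _; rewrite lee_fin gamma_kernel_ge0.
  have k0 : (0 <= (gamma_kernel q t)%:E)%E by rewrite lee_fin gamma_kernel_ge0.
  rewrite mul1e -(ge0_integralZr mu measurableT mf1 f1 k0).
  by apply: eq_integral => u _; rewrite mul1r -EFinM.
transitivity (\int[mu]_t (eGamma p * (gamma_kernel q t)%:E))%E; last first.
  by apply: eq_integral => t _; rewrite inner.
rewrite (ge0_integralZl mu measurableT (mg q)) //.
by move=> x _; rewrite lee_fin gamma_kernel_ge0.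
Qed.

End gamma_kernel.

(** * Special values and growth of the Gamma integral *)

Section gamma.
Set Implicit Arguments.
Unset Strict Implicit.
Context {R : realType}.
Local Notation mu := (@lebesgue_measure R).
Implicit Types p q t u x : R.

Lemma continuous_powR q x : 0 < x -> {for x, continuous (fun t => t `^ q)}.
Proof.
move=> x0; apply: differentiable_continuous; apply/derivable1_diffP.
by apply: ex_derive; exact: is_derive1_powR.
Qed.

(** The fundamental theorem of calculus is used away from 0, where the integrand may be singular. *)
Lemma integral_powR_itv q x : 0 < q -> 0 < x < 1 ->
  (\int[mu]_(t in `[x, 1%R]) (t `^ (q - 1))%:E = (q^-1 - q^-1 * x `^ q)%R%:E)%E.
Proof.
move=> q0 /andP[x0 x1].
have D t : 0 < t -> is_derive t 1 (fun t => q^-1 * t `^ q) (t `^ (q - 1)).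
  move=> t0; have := is_deriveZ q^-1 (is_derive1_powR q t0).
  by rewrite /GRing.scale /= mulrA mulVf ?gt_eqF // mul1r.
have C t : 0 < t -> {for t, continuous (fun t => q^-1 * t `^ q)}.
  move=> t0; apply: differentiable_continuous; apply/derivable1_diffP.
  by apply: ex_derive; exact: D.
rewrite (@continuous_FTC2 _ _ (fun t => q^-1 * t `^ q)) //.
- by rewrite powR1 mulr1 -EFinB.
- apply: continuous_in_subspaceT => t; rewrite inE /= in_itv /= => /andP[xt _].
  by apply: continuous_powR; exact: lt_le_trans xt.
- split.
  + move=> t; rewrite in_itv /= => /andP[xt _].
    by apply: ex_derive; apply: D; exact: lt_trans xt.
  + by apply: cvg_at_right_filter; exact: C.
  + by apply: cvg_at_left_filter; exact: C.
- move=> t; rewrite in_itv /= => /andP[xt _].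
  by rewrite derive1E; apply: derive_val; apply: D; exact: lt_trans xt.
Qed.

Lemma integral_powR01 q : 0 < q ->
  (\int[mu]_(t in `]0%R, 1%R[) (t `^ (q - 1))%:E = (q^-1)%:E)%E.
Proof.
(* The lower ends 1/(n+2) exhaust ]0, 1] for monotone convergence; the shift by one keeps even the
   first of them strictly below 1. *)
move=> q0; pose e n : R := harmonic n.+1.
have e0 n : 0 < e n by exact: harmonic_gt0.
have e1 n : e n < 1 by rewrite /e /= invf_lt1 // ltr1n.
have mf (D : set R) : measurable_fun D (fun t => (t `^ (q - 1))%:E).
  by apply/measurable_EFinP; apply: measurable_funTS; exact: measurable_powR.
rewrite integral_itv_bndo_bndc //.
have UE : \bigcup_n `[e n, 1]%classic = `]0, 1]%classic.
  apply/seteqP; split => [t [n _]|t] /=; rewrite !in_itv /=.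
    by move=> /andP[et ->]; rewrite (lt_le_trans (e0 n) et).
  move=> /andP[t0 t1]; have /cvgrPdist_lt /(_ _ t0)[n _ en] := @cvg_harmonic R.
  exists n => //=; rewrite in_itv /= t1 andbT.
  by have := en n.+1 (leqnSn n); rewrite /= sub0r normrN gtr0_norm // => /ltW.
have nd : nondecreasing_seq (fun n => `[e n, 1]%classic).
  apply/nondecreasing_seqP => n; apply/subsetPset => t /=; rewrite !in_itv /=.
  move=> /andP[et ->]; rewrite andbT (le_trans _ et) //.
  by rewrite /e /= lef_pV2 ?posrE // ler_nat.
rewrite -UE; have /cvg_lim <- // := ge0_nondecreasing_set_cvg_integral nd
  (fun n => measurable_itv `[e n, 1]) (fun n => mf `[e n, 1]%classic)
  (fun n t _ => powR_ge0 t (q - 1)) (mu := mu).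
apply/cvg_lim => //.
under eq_fun do rewrite integral_powR_itv ?e0 ?e1 //.
apply/cvg_EFin; first exact: nearW.
rewrite -[X in _ --> X]subr0 -[X in _ - X](mulr0 q^-1).
apply: cvgB; first exact: cvg_cst.
apply: cvgMr; have /cvg_at_rightP := powR_cvg0 q0; apply; split => //.
by have := @cvg_harmonic R; rewrite -cvg_shiftS.
Qed.

Lemma eBeta1 q : 0 < q -> eBeta 1 q = (q^-1)%:E.
Proof.
move=> q0; rewrite -integral_powR01 // /eBeta integral_restrict_EFin.
by apply: eq_integral => t _; rewrite subrr powRr0 mul1r.
Qed.

(** The integrand is the density of the exponential law of rate 1, whose total mass is 1. *)
Lemma eGamma1 : eGamma 1 = 1%E :> \bar R.
Proof.
rewrite -(integral_exponential_pdf (@ltr01 R)) /eGamma /gamma_kernel.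
rewrite /exponential_pdf.
rewrite !integral_restrict_EFin integral_itv_obnd_cbnd; last first.
  apply/measurable_EFinP; apply: measurable_funTS; apply: measurable_funM.
    exact: measurable_powR.
  by apply: measurableT_comp => //; exact: measurable_expR.
by apply: eq_integral => t _; rewrite subrr powRr0 /= mulN1r.
Qed.

Lemma eGamma_ge0 p : (0 <= eGamma p)%E.
Proof. by apply: integral_ge0 => x _; rewrite lee_fin gamma_kernel_ge0. Qed.

Lemma eBeta_ge0 p q : (0 <= eBeta p q)%E.
Proof. by apply: integral_ge0 => x _; rewrite lee_fin beta_kernel_ge0. Qed.

(** This is s <= e^s at s = t/(2q), raised to the power q. *)
Lemma powR_le_expR q t : 0 < q -> 0 < t -> t `^ q <= (2 * q) `^ q * expR (t / 2).
Proof.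
move=> q0 t0; have d0 : 0 < 2 * q by rewrite mulr_gt0.
have s0 : 0 <= t / (2 * q) by rewrite divr_ge0 ?ltW.
have -> : t `^ q = (2 * q) `^ q * (t / (2 * q)) `^ q.
  by rewrite -powRM ?(ltW d0) // [2 * q * _]mulrC divfK ?lt0r_neq0.
rewrite ler_pM2l ?powR_gt0 //.
have -> : expR (t / 2) = expR (t / (2 * q)) `^ q.
  by rewrite -expRM; congr expR; field; rewrite gt_eqF.
rewrite ge0_ler_powR ?nnegrE ?expR_ge0 ?(ltW q0) //.
by apply: le_trans (expR_ge1Dx _); rewrite lerDr.
Qed.

(* The bound t^q <= (2q)^q e^(t/2) costs half of the exponential decay, and
   rescaling t by 2 restores it at the price of the factor 2^z. *)
Lemma eGammaD_le z q : 0 < q ->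
  (eGamma (z + q) <= ((2 * q) `^ q * 2 `^ z)%:E * eGamma z)%E.
Proof.
move=> q0; have mg p : measurable_fun setT (fun x => (gamma_kernel p x)%:E).
  by apply/measurable_EFinP; exact: measurable_gamma_kernel.
have h0 : 0 < 2^-1 :> R by rewrite invr_gt0.
(* The division by 2 is the Jacobian of the rescaling. *)
pose c := (2 * q) `^ q * 2 `^ z / 2.
have c0 : 0 <= c by rewrite !mulr_ge0 ?powR_ge0.
have mg2 : measurable_fun setT (fun x => (gamma_kernel z (2^-1 * x + 0))%:E).
  by apply: (measurableT_comp (mg z)); exact: measurable_affine.
rewrite [X in (_ * X)%E](ge0_integral_affine 0 h0 (mg z)); last first.
  by move=> t; rewrite lee_fin gamma_kernel_ge0.
rewrite muleA -EFinM -/c -ge0_integralZl //; last first.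
  by move=> t _; rewrite lee_fin gamma_kernel_ge0.
apply: ge0_le_integral => //.
- by move=> t _; rewrite lee_fin gamma_kernel_ge0.
- exact: mg.
- exact: measurable_funeM.
move=> t _; rewrite addr0 -EFinM lee_fin.
have [t0|t0] := leP t 0.
  by rewrite gamma_kernel_le0E // mulr_ge0 ?gamma_kernel_ge0.
have t2 : 0 < 2^-1 * t by rewrite mulr_gt0.
rewrite !gamma_kernel_gt0E // powRM ?(ltW t0) ?(ltW h0) //.
have -> : t `^ (z + q - 1) = t `^ q * t `^ (z - 1).
  by rewrite -powRD ?(gt_eqF t0) ?implybT //; congr (_ `^ _); ring.
have -> : 2^-1 `^ (z - 1) = 2 / 2 `^ z :> R.
  rewrite -powR_inv1 // -powRrM mulN1r opprB powRB ?powRr1 //.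
  by rewrite pnatr_eq0 implybT.
have -> : expR (- t) = expR (- (2^-1 * t)) / expR (t / 2).
  by rewrite -expRN -expRD; congr expR; field.
have -> : c * (2 / 2 `^ z * t `^ (z - 1) * expR (- (2^-1 * t))) =
   (2 * q) `^ q * (t `^ (z - 1) * expR (- (2^-1 * t))).
  by rewrite /c; field; rewrite gt_eqF ?powR_gt0.
rewrite [leLHS](_ : _ = (t `^ q / expR (t / 2)) *
  (t `^ (z - 1) * expR (- (2^-1 * t)))); last by ring.
rewrite ler_wpM2r ?mulr_ge0 ?powR_ge0 ?expR_ge0 //.
by rewrite ler_pdivrMr ?expR_gt0 // powR_le_expR.
Qed.

End gamma.

(* Keeps unification from unfolding the integrals. *)
Local Opaque Gamma.

(** * The real-valued Gamma function and the Beta formula *)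

Section gamma_beta.
Set Implicit Arguments.
Unset Strict Implicit.
Context {R : realType}.
Local Notation mu := (@lebesgue_measure R).
Implicit Types p q t u x : R.

Lemma eGamma1D q : 0 < q -> eGamma (1 + q) = (q%:E * eGamma q)%E.
Proof.
move=> q0; have := eGammaM 1 q; rewrite eGamma1 mul1e eBeta1 // => ->.
by rewrite muleCA -EFinM divff ?gt_eqF // mule1.
Qed.

(** [eGammaD_le] at z = 1 makes [eGamma (1 + p)] finite, and the recurrence, valid in the extended
    reals, would make it infinite if [eGamma p] were. *)
Lemma eGamma_fin_num p : 0 < p -> eGamma p \is a fin_num.
Proof.
move=> p0; rewrite ge0_fin_numE ?eGamma_ge0 //.
have : (eGamma (1 + p) < +oo)%E.
  by apply: le_lt_trans (eGammaD_le _ p0) _; rewrite eGamma1 mule1 ltry.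
rewrite eGamma1D //; case: (eGamma p) (eGamma_ge0 p) => [r _||] //.
  by rewrite !ltry.
by rewrite gt0_muley ?lte_fin.
Qed.

Lemma eGammaE p : 0 < p -> eGamma p = (Gamma p)%:E.
Proof. by move=> p0; rewrite GammaE fineK ?eGamma_fin_num. Qed.

Lemma Gamma1 : Gamma 1 = 1 :> R.
Proof. by rewrite GammaE eGamma1. Qed.

Lemma GammaD1 p : 0 < p -> Gamma (p + 1) = p * Gamma p.
Proof.
move=> p0; apply: EFin_inj; rewrite EFinM -!eGammaE ?addr_gt0 //.
by rewrite addrC eGamma1D.
Qed.

(** Only the part of Euler's integral over [M, M+1] is kept. As M is free, Gamma outgrows every
    geometric sequence. *)
Lemma Gamma_ge p (M : R) : 1 <= p -> 0 < M ->
  M `^ (p - 1) * expR (- (M + 1)) <= Gamma p.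
Proof.
move=> p1 M0; rewrite -lee_fin -eGammaE ?(lt_le_trans ltr01) //.
set c := M `^ _ * _.
have c0 : 0 <= c by rewrite mulr_ge0 ?powR_ge0 ?expR_ge0.
have <- : (\int[mu]_(x in `[M, (M + 1)%R]) (cst c%:E) x = c%:E)%E.
  rewrite integral_cst //= lebesgue_measure_itv /= lte_fin ltrDl ltr01.
  by rewrite -EFinB addrAC subrr add0r mule1.
have mg D : measurable_fun D (fun x => (gamma_kernel p x)%:E).
  apply: measurable_funTS; apply/measurable_EFinP; exact: measurable_gamma_kernel.
apply: (@le_trans _ _ (\int[mu]_(x in `[M, (M + 1)%R]) (gamma_kernel p x)%:E)%E).
  apply: ge0_le_integral => //; first exact: mg.
  move=> x; rewrite /= in_itv /= => /andP[Mx xM].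
  have x0 : 0 < x by exact: lt_le_trans Mx.
  rewrite lee_fin gamma_kernel_gt0E // ler_pM ?powR_ge0 ?expR_ge0 //.
    by rewrite ge0_ler_powR ?nnegrE ?subr_ge0 // ?ltW.
  by rewrite ler_expR lerN2.
apply: ge0_subset_integral => //; first exact: mg.
by move=> x _; rewrite lee_fin gamma_kernel_ge0.
Qed.

(** [Gamma_ge] asks for an argument at least 1, so it is applied at p + 1 and the recurrence leads
    back to p. *)
Lemma Gamma_gt0 p : 0 < p -> 0 < Gamma p.
Proof.
move=> p0; rewrite -(pmulr_rgt0 _ p0) -GammaD1 //.
have p1 : 1 <= p + 1 by rewrite lerDr ltW.
apply: lt_le_trans (Gamma_ge p1 ltr01).
by rewrite mulr_gt0 ?powR_gt0 ?expR_gt0.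
Qed.

Lemma GammaD_le z q : 0 < z -> 0 < q ->
  Gamma (z + q) <= (2 * q) `^ q * 2 `^ z * Gamma z.
Proof.
move=> z0 q0; rewrite -lee_fin EFinM -!eGammaE ?addr_gt0 //.
exact: eGammaD_le.
Qed.

(** The iterated recurrence, with factors in decreasing order to match those produced by repeated
    differentiation. *)
Lemma Gamma_falling (z : R) (m : nat) : 0 < z ->
  Gamma (z + m%:R) = \prod_(i < m) (z + m%:R - i.+1%:R) * Gamma z.
Proof.
move=> z0; elim: m => [|m IH]; first by rewrite big_ord0 mul1r addr0.
rewrite big_ord_recl /= -[m.+1%:R]natr1 addrA.
rewrite GammaD1; last by rewrite ltr_wpDr.
rewrite IH mulrA.
congr (_ * _ * _); first by ring.
by apply: eq_bigr => i _; rewrite -[i.+2%:R]natr1 /bump /=; ring.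
Qed.

Lemma eBetaE p q : 0 < p -> 0 < q ->
  eBeta p q = (Gamma p * Gamma q / Gamma (p + q))%:E.
Proof.
move=> p0 q0; have pq0 : 0 < p + q by rewrite addr_gt0.
have := eGammaM p q; rewrite !eGammaE //.
have G0 := Gamma_gt0 pq0.
case: (eBeta p q) (eBeta_ge0 p q) => [b _||] //; last by rewrite gt0_muley ?lte_fin.
by rewrite -!EFinM => -[->]; rewrite mulrAC divff ?mul1r ?gt_eqF.
Qed.

(** Up to 1/Gamma(p), the integrand of the Riemann-Liouville integral of order p of t^(q-1). *)
Definition convolution_kernel p q x t := (x - t) `^ (p - 1) * t `^ (q - 1).

Lemma measurable_convolution_kernel p q x (D : set R) :
  measurable_fun D (convolution_kernel p q x).
Proof.
apply: measurable_funTS; apply: measurable_funM; last exact: measurable_powR.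
apply: (measurableT_comp (measurable_powR _)); exact: measurable_funB.
Qed.

Lemma integral_convolution_kernel p q x : 0 < p -> 0 < q -> 0 < x ->
  (\int[mu]_(t in `]0%R, x[) (convolution_kernel p q x t)%:E =
   (x `^ (p + q - 1) * (Gamma p * Gamma q / Gamma (p + q)))%R%:E)%E.
Proof.
move=> p0 q0 x0; rewrite -integral_restrict_EFin.
have mg : measurable_fun setT
    (fun t => (gamma_kernel p (x - t) * gamma_kernel q t)%:E).
  apply/measurable_EFinP; apply: measurable_funM; last exact: measurable_gamma_kernel.
  apply: (measurableT_comp (measurable_gamma_kernel _)); exact: measurable_funB.
(* Up to the factor e^-x, the integrand is that of [gamma_kernel_convolution]. *)
transitivity (\int[mu]_t ((expR x)%:E *
    (gamma_kernel p (x - t) * gamma_kernel q t)%:E))%E.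
  apply: eq_integral => t _; rewrite -EFinM; congr EFin.
  rewrite patchE; case: ifPn; last first.
    rewrite notin_setE /= in_itv /= => /negP; rewrite negb_and -!leNgt.
    move=> /orP[t0|xt]; first by rewrite (@gamma_kernel_le0E _ q) ?mulr0.
    by rewrite (@gamma_kernel_le0E _ p) ?mul0r ?mulr0 // subr_le0.
  rewrite inE /= in_itv /= => /andP[t0 tx].
  rewrite !gamma_kernel_gt0E ?subr_gt0 // /convolution_kernel.
  have -> : expR x = (expR (- (x - t)) * expR (- t))^-1.
    by rewrite -expRD -expRN; congr expR; ring.
  by field; rewrite !gt_eqF ?expR_gt0.
rewrite ge0_integralZl //; last first.
  by move=> t _; rewrite lee_fin mulr_ge0 ?gamma_kernel_ge0.
rewrite gamma_kernel_convolution eBetaE // gamma_kernel_gt0E // -!EFinM.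
congr EFin; rewrite expRN [_ * (expR x)^-1]mulrC -!mulrA mulVKf //.
by rewrite gt_eqF ?expR_gt0.
Qed.

Lemma integrable_convolution_kernel p q x : 0 < p -> 0 < q -> 0 < x ->
  mu.-integrable `]0, x[ (EFin \o convolution_kernel p q x).
Proof.
move=> p0 q0 x0; apply/integrableP; split.
  by apply/measurable_EFinP; exact: measurable_convolution_kernel.
under eq_integral => t _ do rewrite /= ger0_norm ?mulr_ge0 ?powR_ge0 //.
by rewrite integral_convolution_kernel // ltry.
Qed.

End gamma_beta.

(** * Everywhere convergent power series *)

Section power_series.
Set Implicit Arguments.
Unset Strict Implicit.
Context {R : realType}.
Implicit Types (a b : nat -> R) (x y r s nu : R).

(* Coefficients of a power series with infinite radius of convergence. *)
Definition entire a := forall r, 0 < r -> exists C, forall k, `|a k| <= C * r ^+ k.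

Definition psum a y : R := limn (pseries a y).

Lemma entire_cvg_norm a y : entire a -> cvgn (pseries (fun k => `|a k|) `|y|).
Proof.
(* With this r, r|y| <= 1/2, so the series is dominated by a geometric one of ratio 1/2. *)
move=> ea; pose r := (2 * (`|y| + 1))^-1.
have y1 : 0 < `|y| + 1 by rewrite ltr_wpDl.
have r0 : 0 < r by rewrite invr_gt0 mulr_gt0.
have [C aC] := ea r r0.
have C0 : 0 <= C by have := aC 0%N; rewrite expr0 mulr1; apply: le_trans.
apply: (@series_le_cvg _ _ (geometric C 2^-1)).
- by move=> k /=; rewrite mulr_ge0 ?exprn_ge0.
- by move=> k /=; rewrite mulr_ge0 ?exprn_ge0 ?invr_ge0.
- move=> k /=; apply: le_trans (_ : C * r ^+ k * `|y| ^+ k <= _).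
    by rewrite ler_wpM2r ?exprn_ge0.
  rewrite -mulrA -exprMn ler_wpM2l // lerXn2r ?nnegrE ?mulr_ge0 ?(ltW r0) ?invr_ge0 //.
  rewrite /r invfM -mulrA ler_piMr ?invr_ge0 // mulrC ler_pdivrMr // mul1r.
  by rewrite lerDl.
- by apply: is_cvg_geometric_series; rewrite gtr0_norm ?invr_gt0 // invf_lt1 // ltr1n.
Qed.

Lemma entire_cvg a y : entire a -> cvgn (pseries a y).
Proof.
move=> /(@entire_cvg_norm _ y) c; apply: normed_cvg.
by rewrite (_ : [normed _] = pseries (fun k => `|a k|) `|y|) //; apply/funext => n;
  apply: eq_bigr => k _; rewrite /= normrM normrX.
Qed.

(** Geometric growth of ratio s is absorbed by using the bound on [a] at r/s. *)
Lemma entireM a b (B s : R) : 0 < s -> (forall k, `|b k| <= B * s ^+ k) ->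
  entire a -> entire (fun k => b k * a k).
Proof.
move=> s0 bB ea r r0; have [C aC] := ea _ (divr_gt0 r0 s0).
exists (B * C) => k; rewrite normrM.
have -> : B * C * r ^+ k = (B * s ^+ k) * (C * (r / s) ^+ k).
  by rewrite expr_div_n; field; rewrite expf_neq0 ?gt_eqF.
by rewrite ler_pM.
Qed.

Lemma entire_shift a : entire a -> entire (fun k => a k.+1).
Proof.
move=> ea r r0; have [C aC] := ea _ r0; exists (C * r) => k.
by rewrite -mulrA -exprS.
Qed.

Lemma entire_unshift a c : entire a ->
  entire (fun k => if k is k'.+1 then a k' else c).
Proof.
(* [|c|] serves the new constant term; C/r pays for the power of r lost by the shift. *)
move=> ea r r0; have [C aC] := ea _ r0; exists (`|c| + C / r) => -[|k].
  rewrite expr0 mulr1 lerDl divr_ge0 ?(ltW r0) //.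
  by have := aC 0%N; rewrite expr0 mulr1; apply: le_trans.
have -> : (`|c| + C / r) * r ^+ k.+1 = `|c| * r ^+ k.+1 + C * r ^+ k.
  by rewrite exprS; field; rewrite gt_eqF.
rewrite (le_trans (aC k)) //.
by rewrite lerDr !mulr_ge0 ?exprn_ge0 ?(ltW r0).
Qed.

Lemma natr_le_expr2 k : k%:R <= 2 ^+ k :> R.
Proof. by rewrite -natrX ler_nat ltnW // ltn_expl. Qed.

Lemma entire_affine a s nu : entire a -> entire (fun k => (s + nu * k%:R) * a k).
Proof.
apply: (@entireM _ _ (`|s| + `|nu|) 2) => // k.
rewrite (le_trans (ler_normD _ _)) // mulrDl lerD //.
  by rewrite ler_peMr // -natrX ler1n expn_gt0.
by rewrite normrM ler_wpM2l // ger0_norm ?ler0n // natr_le_expr2.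
Qed.

Lemma entire_diffs a : entire a -> entire (pseries_diffs a).
Proof.
move=> /entire_shift /(@entire_affine _ 1 1).
by congr entire; apply/funext => k; rewrite /pseries_diffs mul1r -natr1 addrC.
Qed.

Lemma is_derive_psum a y : entire a ->
  is_derive y 1 (psum a) (psum (pseries_diffs a) y).
Proof.
move=> ea; apply: (@pseries_snd_diffs _ _ (`|y| + 1)).
- exact: entire_cvg.
- by apply: entire_cvg; exact: entire_diffs.
- by apply: entire_cvg; do 2 apply: entire_diffs.
- by rewrite [ltRHS]ger0_norm ?addr_ge0 // ltrDl.
Qed.

Lemma psum_recl a y : entire a -> psum a y = a 0 + y * psum (fun k => a k.+1) y.
Proof.
move=> ea; apply/cvg_lim => //.
rewrite -cvg_shiftS.
have -> : (fun n => pseries a y n.+1) =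
    (fun n => a 0 + y * pseries (fun k => a k.+1) y n).
  apply/funext => n; rewrite /pseries /series /= big_nat_recl // expr0 mulr1.
  congr (_ + _).
  by rewrite big_distrr /=; apply: eq_bigr => k _; rewrite exprS mulrCA.
apply: cvgD; first exact: cvg_cst.
apply: cvgMl_tmp; exact: entire_cvg (entire_shift ea).
Qed.

Lemma psum0 a : psum a 0 = a 0.
Proof.
apply/cvg_lim => //; rewrite -cvg_shiftS.
have -> : (fun n => pseries a 0 n.+1) = cst (a 0).
  apply/funext => n; rewrite /pseries /series /= big_nat_recl // expr0 mulr1.
  by rewrite big1 ?addr0 // => k _; rewrite expr0n mulr0.
exact: cvg_cst.
Qed.

(** The Euler operator y d/dy multiplies the k-th coefficient by k. *)
Lemma psum_affine a s nu y : entire a ->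
  psum (fun k => (s + nu * k%:R) * a k) y =
  s * psum a y + nu * (y * psum (pseries_diffs a) y).
Proof.
move=> ea; have ek : entire (fun k => k%:R * a k).
  have := @entire_affine _ 0 1 ea.
  by congr entire; apply/funext => k; rewrite add0r mul1r.
have -> : y * psum (pseries_diffs a) y = psum (fun k => k%:R * a k) y.
  by rewrite [RHS]psum_recl // mul0r add0r.
apply/cvg_lim => //.
have -> : pseries (fun k => (s + nu * k%:R) * a k) y =
    (fun n => s * pseries a y n + nu * pseries (fun k => k%:R * a k) y n).
  apply/funext => n; rewrite /pseries /series /= !big_distrr -big_split /=.
  by apply: eq_bigr => k _; ring.
by apply: cvgD; apply: cvgMl_tmp; exact: entire_cvg.
Qed.

Lemma psumZ a s y : entire a -> psum (fun k => s * a k) y = s * psum a y.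
Proof.
move=> ea; rewrite -[RHS]addr0 -[X in _ + X](mul0r (y * psum (pseries_diffs a) y)).
rewrite -psum_affine //; congr (psum _ _); apply/funext => k.
by rewrite mul0r addr0.
Qed.

Lemma psum_continuous a : entire a -> continuous (psum a).
Proof.
move=> ea y; apply: differentiable_continuous; apply/derivable1_diffP.
by apply: ex_derive; exact: is_derive_psum.
Qed.

(** For x > 0 this is the series of a_k x^(s + nu k), a form stable under differentiation. *)
Definition fpsum nu s a x : R := x `^ s * psum a (x `^ nu).

Lemma is_derive_fpsum nu s a x : entire a -> 0 < x ->
  is_derive x 1 (fpsum nu s a) (fpsum nu (s - 1) (fun k => (s + nu * k%:R) * a k) x).
Proof.
move=> ea x0.
have D1 := is_derive1_powR s x0.
have D2 := @is_derive1_comp _ _ (@powR R ^~ nu) _ _ _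
  (is_derive_psum (x `^ nu) ea) (is_derive1_powR nu x0).
apply: is_derive_eq (is_deriveM D1 D2) _.
rewrite /fpsum psum_affine // /GRing.scale /=.
have -> : x `^ s = x * x `^ (s - 1).
  rewrite -{2}[x](@powRr1 _ x) ?(ltW x0) // -powRD ?(gt_eqF x0) ?implybT //.
  by rewrite addrC subrK.
have -> : x `^ nu = x * x `^ (nu - 1).
  rewrite -{2}[x](@powRr1 _ x) ?(ltW x0) // -powRD ?(gt_eqF x0) ?implybT //.
  by rewrite addrC subrK.
ring.
Qed.

(** The product is the factor that j differentiations of x^(nu k) bring out. *)
Definition falling_coef nu (j : nat) a k := \prod_(i < j) (nu * k%:R - i%:R) * a k.

Lemma entire_falling nu j a : entire a -> entire (falling_coef nu j a).
Proof.
move=> ea; elim: j => [|j IH].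
  by move: ea; congr entire; apply/funext => k; rewrite /falling_coef big_ord0 mul1r.
have := @entire_affine _ (- j%:R) nu IH; congr entire; apply/funext => k.
by rewrite /falling_coef big_ord_recr /=; ring.
Qed.

(** Induction on j with [is_derive_fpsum]. Agreement on x > 0 suffices, since every positive point
    has a neighbourhood of positive points. *)
Lemma derive1n_psum nu a (f : R -> R) (j : nat) : entire a ->
  (forall x, 0 < x -> f x = psum a (x `^ nu)) ->
  forall x, 0 < x -> derive1n j f x = fpsum nu (- j%:R) (falling_coef nu j a) x /\
    derivable (derive1n j f) x 1.
Proof.
move=> ea fE.
have D j' : (forall x, 0 < x ->
    derive1n j' f x = fpsum nu (- j'%:R) (falling_coef nu j' a) x) ->
    forall x, 0 < x -> is_derive x 1 (derive1n j' f)
     (fpsum nu (- j'.+1%:R) (falling_coef nu j'.+1 a) x).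
  move=> H x x0.
  have -> : fpsum nu (- j'.+1%:R) (falling_coef nu j'.+1 a) x =
    fpsum nu (- j'%:R - 1)
      (fun k => (- j'%:R + nu * k%:R) * falling_coef nu j' a k) x.
    rewrite /fpsum -natr1 opprD; congr (_ * psum _ _); apply/funext => k.
    by rewrite /falling_coef big_ord_recr /=; ring.
  apply: (@near_eq_is_derive _ _ _ (fpsum nu (- j'%:R) (falling_coef nu j' a))) => //.
  - by near=> z; rewrite H //; near: z; exact: lt_nbhsr.
  - by apply: is_derive_fpsum => //; exact: entire_falling.
have H j' : forall x, 0 < x ->
    derive1n j' f x = fpsum nu (- j'%:R) (falling_coef nu j' a) x.
  elim: j' => [x x0|j' IH x x0].
    rewrite derive1n0 fE // /fpsum oppr0 powRr0 mul1r; congr psum.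
    by apply/funext => k; rewrite /falling_coef big_ord0 mul1r.
  by rewrite derive1nS derive1E; apply: derive_val; exact: D.
by move=> x x0; split; [exact: H|apply: ex_derive; exact: D (H j) x x0].
Unshelve. all: by end_near. Qed.

End power_series.

(** * Caputo derivatives of power series in x^nu *)

Section fractional_integral.
Set Implicit Arguments.
Unset Strict Implicit.
Context {R : realType}.
Local Notation mu := (@lebesgue_measure R).
Implicit Types (a c : nat -> R) (p q x y nu : R).

(** The factor t^(nu k) turns q into q + nu k, so each term of the partial sum is a Beta
    integral. *)
Lemma integral_convolution_pseries p q nu c x n :
  0 < p -> 0 < q -> 0 < x -> 0 < nu ->
  mu.-integrable `]0, x[
    (fun t => (convolution_kernel p q x t * pseries c (t `^ nu) n)%:E) /\
  (\int[mu]_(t in `]0%R, x[)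
      (convolution_kernel p q x t * pseries c (t `^ nu) n)%:E =
   (x `^ (p + q - 1) * pseries (fun k => c k *
      (Gamma p * Gamma (q + nu * k%:R) / Gamma (p + (q + nu * k%:R))))
      (x `^ nu) n)%R%:E)%E.
Proof.
move=> p0 q0 x0 nu0; elim: n => [|n [IHi IHe]].
  have E t : (convolution_kernel p q x t * pseries c (t `^ nu) 0)%:E = 0%E.
    by rewrite /pseries /series /= big_geq // mulr0.
  split.
    by rewrite (_ : (fun t => _) = cst 0%E); [exact: integrable0|exact/funext].
  rewrite /pseries /series /= big_geq // mulr0; apply: integral0_eq => t _.
  exact: E.
have qk0 : 0 < q + nu * n%:R by rewrite ltr_wpDr // mulr_ge0 // ltW.
pose F t := ((c n)%:E * (convolution_kernel p (q + nu * n%:R) x t)%:E)%E.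
have iF0 := integrable_convolution_kernel p0 qk0 x0.
have iF : mu.-integrable `]0, x[ F by exact: integrableZl.
have FE : {in `]0%R, x[%classic, forall t,
    (convolution_kernel p q x t * pseries c (t `^ nu) n.+1)%:E =
    ((convolution_kernel p q x t * pseries c (t `^ nu) n)%:E + F t)%E}.
  move=> t; rewrite inE /= in_itv /= => /andP[t0 tx].
  rewrite /F -EFinM -EFinD; congr EFin.
  rewrite /pseries seriesSr /= mulrDr; congr (_ + _).
  rewrite /convolution_kernel -powR_mulrn ?powR_ge0 // -powRrM.
  have -> : t `^ (q + nu * n%:R - 1) = t `^ (q - 1) * t `^ (nu * n%:R).
    by rewrite -powRD ?(gt_eqF t0) ?implybT // addrAC.
  ring.
split.
  apply: eq_integrable (integrableD _ IHi iF) => // t tx.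
  by rewrite FE.
under eq_integral => t tx do rewrite (FE t tx).
rewrite integralD // IHe integralZl //.
rewrite integral_convolution_kernel // -EFinM -EFinD; congr EFin.
rewrite /pseries seriesSr /= mulrDr; congr (_ + _).
rewrite -powR_mulrn ?powR_ge0 // -powRrM.
have -> : x `^ (p + (q + nu * n%:R) - 1) = x `^ (p + q - 1) * x `^ (nu * n%:R).
  by rewrite -powRD ?(gt_eqF x0) ?implybT //; congr (_ `^ _); ring.
ring.
Qed.

Lemma integral_convolution_psum p q nu c x : 0 < p -> 0 < q -> 0 < x -> 0 < nu ->
  entire c ->
  mu.-integrable `]0, x[
    (fun t => (convolution_kernel p q x t * psum c (t `^ nu))%:E) /\
  \int[mu]_(t in `]0, x[) (convolution_kernel p q x t * psum c (t `^ nu)) =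
   x `^ (p + q - 1) * psum (fun k => c k *
      (Gamma p * Gamma (q + nu * k%:R) / Gamma (p + (q + nu * k%:R))))
      (x `^ nu).
Proof.
move=> p0 q0 x0 nu0 ec.
set d := fun k => c k * _.
(* Since t^nu <= x^nu, this constant bounds all partial sums on ]0, x[; Q times the kernel is the
   dominating function. *)
pose Q := psum (fun k => `|c k|) (x `^ nu).
have cK : forall n t, 0 < t < x -> `|pseries c (t `^ nu) n| <= Q.
  move=> n t /andP[t0 tx].
  apply: (@le_trans _ _ (pseries (fun k => `|c k|) (x `^ nu) n)).
    rewrite /pseries /series /= (le_trans (ler_norm_sum _ _ _)) //.
    apply: ler_sum => k _; rewrite normrM normrX ler_wpM2l // ger0_norm ?powR_ge0 //.
    by rewrite lerXn2r ?nnegrE ?powR_ge0 // ge0_ler_powR ?nnegrE // ltW.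
  apply: nondecreasing_cvgn_le.
    apply/nondecreasing_seqP => k; rewrite /pseries seriesSr lerDl.
    by rewrite mulr_ge0 ?exprn_ge0 ?powR_ge0.
  by have := @entire_cvg_norm _ _ (x `^ nu) ec; rewrite ger0_norm ?powR_ge0.
pose f_ n t := (convolution_kernel p q x t * pseries c (t `^ nu) n)%:E.
pose f t := (convolution_kernel p q x t * psum c (t `^ nu))%:E.
pose g t := (Q%:E * (convolution_kernel p q x t)%:E)%E.
have mx : measurable (`]0, x[ : set R) by exact: measurable_itv.
have mf_ n : measurable_fun `]0, x[ (f_ n).
  by case: (integral_convolution_pseries c n p0 q0 x0 nu0) => /integrableP[].
have f_f : {ae mu, forall t, `]0, x[%classic t -> f_ ^~ t @ \oo --> f t}.
  apply: aeW => t _; apply: cvg_EFin; first exact: nearW.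
  by apply: cvgMl_tmp; exact: entire_cvg.
have mf : measurable_fun `]0, x[ f.
  apply: (emeasurable_fun_cvg f_) => // t tx.
  apply: cvg_EFin; first exact: nearW.
  by apply: cvgMl_tmp; exact: entire_cvg.
have ig : mu.-integrable `]0, x[ g.
  by apply: integrableZl => //; exact: integrable_convolution_kernel.
have f_g : {ae mu, forall t n, `]0, x[%classic t -> (`|f_ n t| <= g t)%E}.
  apply: aeW => t n; rewrite /= in_itv /= => tx.
  rewrite /g -EFinM lee_fin normrM mulrC ler_pM ?cK //.
  by rewrite ger0_norm // mulr_ge0 ?powR_ge0.
have [intf _ cvgf] := @dominated_convergence _ _ _ mu _ mx f_ f g mf_ mf f_f ig f_g.
split => //.
have fE : (\int[mu]_(t in `]0%R, x[) f t)%E \is a fin_num.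
  exact: integrable_fin_num.
rewrite /Rintegral -/f.
have cvgL : x `^ (p + q - 1) * pseries d (x `^ nu) n @[n --> \oo] -->
    fine (\int[mu]_(t in `]0%R, x[) f t)%E.
  rewrite (_ : (fun n => _) = fun n => fine (\int[mu]_(t in `]0%R, x[) f_ n t)%E).
    by apply: fine_cvg; rewrite fineK.
  apply/funext => n.
  by case: (integral_convolution_pseries c n p0 q0 x0 nu0) => _ ->.
have xp : x `^ (p + q - 1) != 0 by rewrite gt_eqF // powR_gt0.
(* Convergence of the series with coefficients [d] is a consequence of dominated convergence: the
   nonzero power of x is divided out. *)
have /cvg_lim dE : pseries d (x `^ nu) n @[n --> \oo] -->
    (x `^ (p + q - 1))^-1 * fine (\int[mu]_(t in `]0%R, x[) f t)%E.
  rewrite (_ : (fun n => _) = fun n => (x `^ (p + q - 1))^-1 *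
    (x `^ (p + q - 1) * pseries d (x `^ nu) n)); first exact: cvgMl_tmp.
  by apply/funext => n; rewrite mulKf.
by rewrite /psum dE // mulVKf.
Qed.

End fractional_integral.

(** * Termwise Caputo differentiation *)

Section caputo_of_power_series.
Set Implicit Arguments.
Unset Strict Implicit.
Context {R : realType}.
Local Notation mu := (@lebesgue_measure R).
Implicit Types (a c : nat -> R) (f : R -> R) (x y nu : R) (k n : nat).

(** With m the order, the upper bound makes t^(nu-m) integrable at 0; the lower one, strict for
    non-integer [nu], does the same for (x-t)^(m-nu-1) at x. *)
Lemma caputo_order_bounds nu : 0 < nu ->
  nu <= (caputo_order nu)%:R < nu + 1.
Proof.
move=> nu0; have c0 : (0 <= Num.ceil nu) by rewrite ltW // ceil_gt0.
have -> : (caputo_order nu)%:R = (Num.ceil nu)%:~R :> R.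
  by rewrite /caputo_order -[in RHS](gez0_abs c0).
by rewrite ceil_ge /= -ltrBlDr -[1]/(1%:~R) -intrB ceilB1_lt.
Qed.

Lemma caputo_order_nat nu : nu \is a Num.nat -> (caputo_order nu)%:R = nu.
Proof.
by move=> /natrP[n ->]; rewrite /caputo_order -[n%:R]/((Posz n)%:~R) intrKceil.
Qed.

Lemma caputo_order_gt0 nu : 0 < nu -> (0 < caputo_order nu)%N.
Proof.
move=> nu0; have /andP[h _] := caputo_order_bounds nu0.
by rewrite -(ltr0n R) (lt_le_trans nu0).
Qed.

(** The Caputo derivative sends x^(nu (k+1)) to this multiple of x^(nu k). *)
Definition Gamma_ratio nu k := Gamma (nu * k.+1%:R + 1) / Gamma (nu * k%:R + 1).

Definition caputo_coef nu a k := Gamma_ratio nu k * a k.+1.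

Lemma Gamma_ratio_ge0 nu k : 0 < nu -> 0 <= Gamma_ratio nu k.
Proof.
by move=> nu0; rewrite divr_ge0 // ltW // Gamma_gt0 // ltr_wpDl // mulr_ge0 // ltW.
Qed.

(** [GammaD_le] at z = nu k + 1 and q = nu; geometric growth is what [entireM] tolerates. *)
Lemma Gamma_ratio_le nu k : 0 < nu ->
  `|Gamma_ratio nu k| <= (2 * nu) `^ nu * 2 * (2 `^ nu) ^+ k.
Proof.
move=> nu0; rewrite ger0_norm ?Gamma_ratio_ge0 //.
have z0 : 0 < nu * k%:R + 1 by rewrite ltr_wpDl // mulr_ge0 // ltW.
rewrite ler_pdivrMr ?Gamma_gt0 //.
have -> : nu * k.+1%:R + 1 = nu * k%:R + 1 + nu by rewrite -natr1; ring.
apply: (le_trans (GammaD_le z0 nu0)).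
rewrite -powR_mulrn ?powR_ge0 // -powRrM -[_ * 2 * _]mulrA.
have -> : 2 `^ (nu * k%:R + 1) = 2 * 2 `^ (nu * k%:R) :> R.
  by rewrite powRD ?powRr1 1?mulrC // pnatr_eq0 implybT.
by [].
Qed.

Lemma entire_caputo_coef nu a : 0 < nu -> entire a -> entire (caputo_coef nu a).
Proof.
move=> nu0 ea; apply: (entireM (s := 2 `^ nu)).
- by rewrite powR_gt0.
- by move=> k; exact: Gamma_ratio_le.
- exact: entire_shift.
Qed.

(** [Gamma_falling] with m the order and z = nu (k+1) - m + 1, positive because m < nu + 1. At index
    0 the argument would be 1 - m <= 0. *)
Lemma falling_coef_Gamma nu a k : 0 < nu ->
  falling_coef nu (caputo_order nu) a k.+1 =
  Gamma (nu * k.+1%:R + 1) /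
    Gamma (nu - (caputo_order nu)%:R + 1 + nu * k%:R) * a k.+1.
Proof.
move=> nu0; set m := caputo_order nu; set z := _ + nu * _.
have /andP[_ mnu] := caputo_order_bounds nu0.
have z0 : 0 < z by rewrite ltr_wpDr ?mulr_ge0 ?(ltW nu0) // addrAC subr_gt0.
have -> : nu * k.+1%:R + 1 = z + m%:R by rewrite /z -natr1; ring.
rewrite Gamma_falling // mulfK ?gt_eqF ?Gamma_gt0 // /falling_coef.
congr (_ * _); apply: eq_bigr => i _.
by rewrite /z -[i.+1%:R]natr1 -[k.+1%:R]natr1; ring.
Qed.

(** The constant term is killed, so x^nu can be factored out of the series; this improves the
    exponent -m to nu - m > -1. *)
Lemma derive1n_caputo_order nu a f : 0 < nu -> entire a ->
  (forall x, 0 < x -> f x = psum a (x `^ nu)) ->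
  forall x, 0 < x -> derive1n (caputo_order nu) f x =
    x `^ (nu - (caputo_order nu)%:R) *
    psum (fun k => falling_coef nu (caputo_order nu) a k.+1) (x `^ nu).
Proof.
move=> nu0 ea fE x x0; have [-> _] := derive1n_psum (caputo_order nu) ea fE x0.
rewrite /fpsum psum_recl; last exact: entire_falling.
have -> : falling_coef nu (caputo_order nu) a 0 = 0.
  rewrite /falling_coef; case: (caputo_order nu) (caputo_order_gt0 nu0) => // m _.
  by rewrite big_ord_recl mulr0 subr0 !mul0r.
by rewrite add0r mulrA -powRD ?(gt_eqF x0) ?implybT // addrC.
Qed.

Lemma caputo_kernel_psum nu a f x t : 0 < nu -> entire a ->
  (forall x, 0 < x -> f x = psum a (x `^ nu)) -> 0 < t ->
  caputo_kernel nu f x t =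
  convolution_kernel ((caputo_order nu)%:R - nu)
    (nu - (caputo_order nu)%:R + 1) x t *
  psum (fun k => falling_coef nu (caputo_order nu) a k.+1) (t `^ nu).
Proof.
move=> nu0 ea fE t0; rewrite /caputo_kernel (derive1n_caputo_order nu0 ea fE t0).
by rewrite /convolution_kernel addrK mulrA.
Qed.

Lemma caputo_order_gt nu : 0 < nu -> nu \isn't a Num.nat ->
  0 < (caputo_order nu)%:R - nu.
Proof.
move=> nu0 nuN; have /andP[h _] := caputo_order_bounds nu0.
rewrite subr_gt0 lt_neqAle h andbT; apply: contra nuN => /eqP ->.
exact: natr_nat.
Qed.

Lemma caputo_pos_psum nu a f x : 0 < nu -> entire a ->
  (forall x, 0 < x -> f x = psum a (x `^ nu)) -> 0 < x ->
  caputo_pos nu f x = psum (caputo_coef nu a) (x `^ nu).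
Proof.
move=> nu0 ea fE x0; rewrite /caputo_pos; case: ifPn => [nuN|nuN].
  (* For integer [nu] the order is [nu] itself, and the falling factorials are already the Gamma
     ratios. *)
  rewrite (derive1n_caputo_order nu0 ea fE x0) caputo_order_nat // subrr powRr0 mul1r.
  congr (psum _ _); apply/funext => k.
  rewrite (falling_coef_Gamma _ _ nu0) (caputo_order_nat nuN).
  by rewrite subrr add0r [1 + _]addrC.
have /andP[_ mnu] := caputo_order_bounds nu0.
have p0 := caputo_order_gt nu0 nuN.
have q0 : 0 < nu - (caputo_order nu)%:R + 1 by rewrite addrAC subr_gt0.
have ec : entire (fun k => falling_coef nu (caputo_order nu) a k.+1).
  by apply: entire_shift; exact: entire_falling.
have [_ I] := integral_convolution_psum p0 q0 x0 nu0 ec.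
have IE : {in `]0, x[%classic, caputo_kernel nu f x =1 fun t =>
    convolution_kernel ((caputo_order nu)%:R - nu)
    (nu - (caputo_order nu)%:R + 1) x t *
    psum (fun k => falling_coef nu (caputo_order nu) a k.+1) (t `^ nu)}.
  move=> t; rewrite inE /= in_itv /= => /andP[t0 _].
  exact: (caputo_kernel_psum x nu0 ea fE t0).
under eq_Rintegral => t tx do rewrite (IE t tx).
rewrite I.
(* The two exponents p = m - nu and q = nu - m + 1 add up to 1, so no power of x remains in
   front. *)
have -> : (caputo_order nu)%:R - nu + (nu - (caputo_order nu)%:R + 1) - 1 = 0.
  by ring.
rewrite powRr0 mul1r.
set G := Gamma ((caputo_order nu)%:R - nu).
have G0 : G != 0 by rewrite gt_eqF // Gamma_gt0.
rewrite -[RHS](mulKf G0) -(@psumZ _ (caputo_coef nu a));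
  last exact: entire_caputo_coef.
(* Here v = Gamma(q + nu k), the denominator of the falling factorial, cancels against the Beta
   integral, and g = Gamma(p) against the normalization. *)
have alg (u v w g z : R) : v != 0 -> w != 0 ->
    u / v * z * (g * v / w) = g * (u / w * z).
  by move=> v0 w0; field; rewrite v0 w0.
congr (_ * psum _ _).
apply/funext => k; rewrite falling_coef_Gamma // /caputo_coef /Gamma_ratio.
have -> : (caputo_order nu)%:R - nu + (nu - (caputo_order nu)%:R + 1 + nu * k%:R) =
  nu * k%:R + 1 by ring.
have nuk : 0 <= nu * k%:R by rewrite mulr_ge0 ?(ltW nu0).
by apply: alg; rewrite lt0r_neq0 // Gamma_gt0 // ?(ltr_wpDl nuk) // ltr_wpDr.
Qed.

Lemma cvg_caputo_pos nu a f : 0 < nu -> entire a ->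
  (forall x, 0 < x -> f x = psum a (x `^ nu)) ->
  caputo_pos nu f y @[y --> 0^'+] --> psum (caputo_coef nu a) (0 `^ nu).
Proof.
move=> nu0 ea fE.
apply: (@cvg_trans _ (psum (caputo_coef nu a) (y `^ nu) @[y --> 0^'+])).
  apply: near_eq_cvg; near=> y; rewrite (caputo_pos_psum nu0 ea fE) //.
rewrite powR0 ?gt_eqF //.
apply: (@cvg_comp _ _ _ (fun y => y `^ nu) (psum (caputo_coef nu a)) _
  (nbhs (0 : R))).
  exact: powR_cvg0.
by apply: psum_continuous; exact: entire_caputo_coef.
Unshelve. all: by end_near. Qed.

Lemma caputo_psum nu a f : 0 < nu -> entire a ->
  (forall x, 0 < x -> f x = psum a (x `^ nu)) ->
  forall x, 0 <= x -> caputo nu f x = psum (caputo_coef nu a) (x `^ nu).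
Proof.
move=> nu0 ea fE x; rewrite le_eqVlt => /predU1P[<-|x0].
  by rewrite /caputo eqxx; apply/cvg_lim => //; exact: cvg_caputo_pos.
by rewrite /caputo gt_eqF // (caputo_pos_psum nu0 ea fE).
Qed.

Lemma caputo_defined_psum nu a f : 0 < nu -> entire a ->
  (forall x, 0 < x -> f x = psum a (x `^ nu)) -> caputo_defined nu f.
Proof.
move=> nu0 ea fE; split.
- by move=> k x _ x0; have [] := derive1n_psum k ea fE x0.
- move=> nuN x x0; have /andP[_ mnu] := caputo_order_bounds nu0.
  have p0 := caputo_order_gt nu0 nuN.
  have q0 : 0 < nu - (caputo_order nu)%:R + 1 by rewrite addrAC subr_gt0.
  have ec : entire (fun k => falling_coef nu (caputo_order nu) a k.+1).
    by apply: entire_shift; exact: entire_falling.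
  have [I _] := integral_convolution_psum p0 q0 x0 nu0 ec.
  apply: eq_integrable I => // t; rewrite inE /= in_itv /= => /andP[t0 _].
  by rewrite (caputo_kernel_psum x nu0 ea fE t0).
- by apply/cvg_ex; eexists; exact: (cvg_caputo_pos nu0 ea fE).
Qed.

Lemma mul_powR_psum nu a f : entire a ->
  (forall x, 0 <= x -> f x = psum a (x `^ nu)) ->
  forall x, 0 < x -> mul_powR nu f x =
    psum (fun k => if k is k'.+1 then a k' else 0) (x `^ nu).
Proof.
move=> ea fE x x0; rewrite /mul_powR fE ?ltW // [RHS]psum_recl ?add0r //.
exact: entire_unshift.
Qed.

Lemma caputo_coef_unshift nu a :
  caputo_coef nu (fun k => if k is k'.+1 then a k' else 0) =
  fun k => Gamma_ratio nu k * a k.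
Proof. by []. Qed.

(** * Mittag-Leffler coefficients and iteration of the operator *)

Definition mittag_leffler_coef n nu (lambda : R) k :=
  lambda ^+ k / Gamma (nu * k%:R + 1) ^+ n.+1.

(* [Gamma_ge] with M = r^(-1/nu), so that M^(nu k) = r^-k. *)
Lemma Gamma_inv_le nu r k : 0 < nu -> 0 < r ->
  (Gamma (nu * k%:R + 1))^-1 <= expR (r^-1 `^ nu^-1 + 1) * r ^+ k.
Proof.
move=> nu0 r0; set M := r^-1 `^ nu^-1.
have M0 : 0 < M by rewrite powR_gt0 ?invr_gt0.
have k1 : 1 <= nu * k%:R + 1 by rewrite lerDr mulr_ge0 // ltW.
have := Gamma_ge k1 M0; rewrite addrK expRN.
have -> : M `^ (nu * k%:R) = r ^- k.
  rewrite /M -powRrM mulrA mulVf ?gt_eqF // mul1r powR_mulrn ?exprVn //.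
  by rewrite invr_ge0 ltW.
move=> h; rewrite -[leRHS]invrK lef_pV2 ?posrE.
- by rewrite invfM mulrC.
- by rewrite Gamma_gt0 // (lt_le_trans ltr01).
- by rewrite invr_gt0 mulr_gt0 ?expR_gt0 ?exprn_gt0.
Qed.

(** One factor 1/Gamma(nu k + 1) is entire by itself; the other n are bounded and lambda^k is
    geometric, so [entireM] applies. *)
Lemma entire_mittag_leffler_coef n nu (lambda : R) : 0 < nu ->
  entire (mittag_leffler_coef n nu lambda).
Proof.
move=> nu0; pose b k := (Gamma (nu * k%:R + 1))^-1.
have b0 k : 0 <= b k.
  by rewrite invr_ge0 ltW // Gamma_gt0 // ltr_wpDl // mulr_ge0 // ltW.
have eb : entire b.
  move=> r r0; exists (expR (r^-1 `^ nu^-1 + 1)) => k.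
  by rewrite ger0_norm ?Gamma_inv_le.
pose B := expR (1^-1 `^ nu^-1 + 1) : R.
have bB k : b k <= B by have := @Gamma_inv_le nu 1 k nu0 ltr01; rewrite expr1n mulr1.
(* Adding 1 keeps the ratio positive when [lambda] is 0. *)
have := @entireM _ b (fun k => lambda ^+ k * b k ^+ n) (B ^+ n) (`|lambda| + 1).
rewrite (_ : (fun k => _ * b k) = mittag_leffler_coef n nu lambda); last first.
  by apply/funext => k; rewrite /mittag_leffler_coef /b -mulrA -exprSr exprVn.
apply => //.
move=> k; rewrite normrM !normrX mulrC ler_pM ?exprn_ge0 //.
  by rewrite lerXn2r ?nnegrE ?expR_ge0 // ger0_norm.
by rewrite lerXn2r ?nnegrE ?addr_ge0 // lerDl.
Qed.

Lemma mittag_leffler_psum n nu (lambda x : R) : 0 < nu ->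
  mittag_leffler n%:R nu 1 (lambda * x `^ nu) =
  psum (mittag_leffler_coef n nu lambda) (x `^ nu).
Proof.
move=> nu0; rewrite /mittag_leffler /psum /pseries; congr (limn (series _)).
apply/funext => k; rewrite /mittag_leffler_coef exprMn natr1 powR_mulrn 1?mulrAC //.
by rewrite ltW // Gamma_gt0 // ltr_wpDl // mulr_ge0 // ltW.
Qed.

(** Index j stands for j + 1 derivatives, hence the exponent. Entireness is carried through the
    induction because the next derivative requires it. *)
Lemma hyper_bessel_psum nu a f : 0 < nu -> entire a ->
  (forall x, 0 < x -> f x = psum a (x `^ nu)) ->
  forall j, let d k := Gamma_ratio nu k ^+ j.+1 * a k.+1 in
  entire d /\ forall x, 0 <= x -> hyper_bessel j nu f x = psum d (x `^ nu).
Proof.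
move=> nu0 ea fE; elim=> [|j [ed IH]] /=.
  under eq_fun do rewrite expr1.
  by split; [exact: entire_caputo_coef|exact: caputo_psum].
pose d k := Gamma_ratio nu k ^+ j.+1 * a k.+1.
have dE : (fun k => Gamma_ratio nu k ^+ j.+2 * a k.+1) =
    caputo_coef nu (fun k => if k is k'.+1 then d k' else 0).
  by apply/funext => k; rewrite caputo_coef_unshift exprS -mulrA.
rewrite dE; have eu := entire_unshift 0 ed.
split; first exact: entire_caputo_coef.
by apply: caputo_psum => //; exact: mul_powR_psum.
Qed.

End caputo_of_power_series.

Theorem theorem3p2 : forall (R : realType) (n : nat) (nu lambda : R),
  0 < nu ->
  eigenfunction (hyper_bessel_defined n nu) (hyper_bessel n nu)
    (fun x : R => mittag_leffler n%:R nu 1 (lambda * x `^ nu)).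
Proof.
move=> R n nu lambda nu0; set f := (fun x : R => _).
pose a := mittag_leffler_coef n nu lambda.
have ea : entire a by exact: entire_mittag_leffler_coef.
have fE x : f x = psum a (x `^ nu) by exact: mittag_leffler_psum.
have fE0 x : 0 < x -> f x = psum a (x `^ nu) by [].
split.
- split; first exact: (caputo_defined_psum nu0 ea fE0).
  (* Every intermediate function, once multiplied by x^nu, is again an entire series in x^nu. *)
  move=> k _; have [ed IH] := hyper_bessel_psum nu0 ea fE0 k.
  apply: (caputo_defined_psum nu0 (entire_unshift 0 ed)).
  exact: mul_powR_psum.
(* At 0 the function takes the value 1/Gamma(1)^(n+1) = 1. *)
- exists 0 => //; rewrite fE (powR0 (lt0r_neq0 nu0)) psum0 /a /mittag_leffler_coef.
  by rewrite mulr0 add0r Gamma1 expr1n expr0 divr1 oner_neq0.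
(* The ratio replaces the Gamma power in a_(k+1) by that of a_k, leaving one extra factor [lambda],
   the eigenvalue. *)
- have dE : (fun k => Gamma_ratio nu k ^+ n.+1 * a k.+1) = fun k => lambda * a k.
    have alg (u v w : R) : u != 0 -> v != 0 ->
        u / v * (lambda * w / u) = lambda * (w / v).
      by move=> u0 v0; field; rewrite u0 v0.
    apply/funext => k.
    rewrite /Gamma_ratio /a /mittag_leffler_coef expr_div_n [lambda ^+ k.+1]exprS.
    by apply: alg; rewrite expf_neq0 // lt0r_neq0 // Gamma_gt0 // ltr_wpDl //
      mulr_ge0 // ltW.
  exists lambda => x x0; have [_ H] := hyper_bessel_psum nu0 ea fE0 n.
  by rewrite (H _ x0) dE fE (psumZ lambda _ ea).
Qed.
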